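(* There exist absolute constants $c_1, c_2 > 0$ such that the following holds. For every function $f:\{\pm1\}^n\to\{\pm1\}$, every distribution $\mu$ over $\{\pm1\}^n$, every $k\in\mathbb{N}$, and every $\gamma,\delta\in(0,1)$, \[ \overline{\mathrm{Depth}}^{\mu^k}\!\left(f^{\otimes k},\,1-e^{-c_1\delta k}-\gamma\right)\;\ge\; c_2\,\frac{\gamma^2 k}{\log(1/\delta)}\cdot \overline{\mathrm{Depth}}^{\mu}(f,\delta). \]
   Context: A deterministic decision tree on $\{\pm1\}^N$ queries input coordinates adaptively and outputs a label at the leaf reached; a randomized decision tree is a probability distribution over deterministic decision trees (on input $x$ it draws a tree $\mathbf{T}$ and outputs $\mathbf{T}(x)$). For a distribution $\mu$ over inputs, the expected depth of a deterministic tree is the expected number of coordinates it queries on $\mathbf{x}\sim\mu$, and the expected depth of a randomized tree is the average of this over its random choice of deterministic tree. For a function $g$ and $\varepsilon\in[0,1]$, $\overline{\mathrm{Depth}}^{\mu}(g,\varepsilon)$ denotes the minimum expected depth (w.r.t. $\mu$) of any randomized decision tree $\mathcal T$ with $\Pr_{\mathbf x\sim\mu}[\mathcal T(\mathbf x)\neq g(\mathbf x)]\le\varepsilon$ (probability over both $\mathbf x$ and the tree's randomness). $\mu^k$ is the $k$-fold product distribution on $(\{\pm1\}^n)^k$, and $f^{\otimes k}:(\{\pm1\}^n)^k\to\{\pm1\}^k$ is the direct product $f^{\otimes k}(X^{(1)},\dots,X^{(k)})=(f(X^{(1)}),\dots,f(X^{(k)}))$; trees for $f^{\otimes k}$ query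 individual bits of the $nk$-bit input and output an element of $\{\pm1\}^k$. *)

(* Defs.v *)
From HB Require Import structures.
From mathcomp Require Import all_boot all_order all_algebra.
From mathcomp Require Import all_classical all_reals all_analysis.

Set Implicit Arguments.
Unset Strict Implicit.
Unset Printing Implicit Defensive.
Import Order.TTheory GRing.Theory Num.Theory.
Local Open Scope classical_set_scope.
Local Open Scope ring_scope.

(* The two-element set {+1, -1}, as booleans: [b] stands for (-1)^b. *)
Notation pm1 := bool.

(* {+1, -1}^I *)
Notation cube I := {ffun I -> pm1}.

Record fdist (R : realType) (T : finType) := FDist {
  pmf :> T -> R;
  pmf_ge0 : forall x, 0 <= pmf x;
  pmf_sum1 : \sum_x pmf x = 1
}.

Inductive dtree (I : finType) (L : pointedType) : Type :=
| Leaf of L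
| Query (i : I) of dtree I L & dtree I L.
Arguments Leaf {I L}.

Fixpoint dtree_eval (I : finType) (L : pointedType) (T : dtree I L) (x : cube I) : L :=
  match T with
  | Leaf l => l
  | Query i T0 T1 => dtree_eval (if x i then T1 else T0) x
  end.

(* The set of coordinates queried by [T] on input [x]. Nothing forbids querying
   a coordinate again further down a path, but this is not counted twice. *)
Fixpoint queried (I : finType) (L : pointedType) (T : dtree I L) (x : cube I) : {set I} :=
  match T with
  | Leaf _ => finset.set0
  | Query i T0 T1 => (i |: queried (if x i then T1 else T0) x)%SET
  end.

HB.instance Definition _ (I : finType) (T : pointedType) :=
  isPointed.Build {ffun I -> T} [ffun=> point].

(* The discrete sigma-algebra on trees. When [L] is countable, so is
   [dtree I L], and the probability measures on it are exactly the probability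
   distributions over trees. *)
HB.instance Definition _ (I : finType) (L : pointedType) :=
  gen_eqMixin (dtree I L).
HB.instance Definition _ (I : finType) (L : pointedType) :=
  gen_choiceMixin (dtree I L).
HB.instance Definition _ (I : finType) (L : pointedType) :=
  isPointed.Build (dtree I L) (Leaf point).
HB.instance Definition _ (I : finType) (L : pointedType) :=
  @isMeasurable.Build default_measure_display (dtree I L)
    (@discrete_measurable (dtree I L)) (@discrete_measurable0 _)
    (@discrete_measurableC _) (@discrete_measurableU _).

Definition rtree (R : realType) (I : finType) (L : pointedType) :=
  probability (dtree I L) R.

Definition dtree_depth (R : realType) (I : finType) (L : pointedType)
    (mu : fdist R (cube I)) (T : dtree I L) : R :=
  \sum_x mu x * #|queried T x|%:R.

Definition rtree_depth (R : realType) (I : finType) (L : pointedType)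
    (mu : fdist R (cube I)) (P : rtree R I L) : \bar R :=
  (\int[P]_T (dtree_depth mu T)%:E)%E.

(* Pr[T(x) <> g(x)] for independent x ~ mu and T ~ P. *)
Definition rtree_error (R : realType) (I : finType) (L : pointedType)
    (mu : fdist R (cube I)) (g : cube I -> L) (P : rtree R I L) : \bar R :=
  (\sum_x (mu x)%:E * P [set T | dtree_eval T x <> g x])%E.

(* For [eps < 0] no tree is admissible, and [Depth mu g eps] is [+oo]. *)
Definition Depth (R : realType) (I : finType) (L : pointedType)
    (mu : fdist R (cube I)) (g : cube I -> L) (eps : R) : \bar R :=
  ereal_inf [set rtree_depth mu P |
               P in [set P : rtree R I L | (rtree_error mu g P <= eps%:E)%E]].

(* ({+1, -1}^n)^k is the cube over the n k coordinates (i, j); the i-th of the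
   k inputs of length n is the i-th block. *)
Definition block (n k : nat) (X : cube ('I_k * 'I_n)%type) (i : 'I_k) :
    cube 'I_n :=
  [ffun j => X (i, j)].

Definition direct_product (n k : nat) (f : cube 'I_n -> pm1)
    (X : cube ('I_k * 'I_n)%type) : cube 'I_k :=
  [ffun i => f (block X i)].

Section fdist_pow.
Variables (R : realType) (n : nat) (mu : fdist R (cube 'I_n)) (k : nat).

Definition fdist_pow_pmf (X : cube ('I_k * 'I_n)%type) : R :=
  \prod_(i < k) mu (block X i).

Lemma fdist_pow_ge0 X : 0 <= fdist_pow_pmf X.
Proof. by apply: prodr_ge0 => i _; exact: pmf_ge0. Qed.

Lemma fdist_pow_sum1 : \sum_X fdist_pow_pmf X = 1.
Proof.
pose curry (X : cube ('I_k * 'I_n)%type) : {ffun 'I_k -> cube 'I_n} :=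
  [ffun i => block X i].
pose uncurry (Y : {ffun 'I_k -> cube 'I_n}) : cube ('I_k * 'I_n)%type :=
  [ffun p => Y p.1 p.2].
have uK : cancel uncurry curry.
  by move=> Y; apply/ffunP => i; apply/ffunP => j; rewrite !ffunE.
have cK : cancel curry uncurry.
  by move=> X; apply/ffunP => -[i j]; rewrite !ffunE.
transitivity (\sum_(Y : {ffun 'I_k -> cube 'I_n}) \prod_(i < k) mu (Y i)).
  rewrite (reindex uncurry); last by exists curry => x _; [exact: uK|exact: cK].
  apply: eq_bigr => Y _; apply: eq_bigr => i _; congr (mu _).
  by rewrite -[in RHS](uK Y) ffunE.
rewrite -(bigA_distr_bigA (fun _ => mu)) /=.
by apply: big1 => i _; exact: pmf_sum1.
Qed.

(* mu^k *)
Definition fdist_pow : fdist R (cube ('I_k * 'I_n)%type) :=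
  FDist fdist_pow_ge0 fdist_pow_sum1.

End fdist_pow.

(* Main.v *)
Require Import Defs.
From mathcomp Require Import all_boot all_order all_algebra.
From mathcomp Require Import all_classical all_reals all_analysis.
From mathcomp Require Import ring lra.
Import Order.TTheory GRing.Theory Num.Theory.
Local Open Scope ring_scope.

(* A hardcore measure for [f] is some [H : {+1,-1}^n -> [0, 1]] of density about
   [delta] with which no shallow tree correlates after multiplication by [f]. It
   arises by minimizing a smooth convex potential over nonnegative combinations
   of trees, with a penalty for their depth: at an almost-minimizer, the
   derivative of the potential is such an [H]. If its density were less than
   [delta / 4], the minimizing combination would have a large margin outside a
   set of measure [delta / 2], and the majority vote of about
   [log(1/delta) / margin^2] of its members would compute [f] too cheaply.

   At a leaf of a tree for the direct product the [k] blocks remain independent.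
   If [D_i] is the density of [H] in block [i] given the leaf and [A_i] its
   correlation there with the best label, the tree succeeds at the leaf with
   probability at most [\prod_i (1 - (D_i - A_i) / 2)]. The [A_i] are small on
   average, since fixing the other blocks turns the tree into one for [f]. The
   [D_i] remain large because [\prod_i (1 - D_i / 4)] is multilinear in the block
   weights, so that its average over the leaves does not depend on the tree. *)

Set Implicit Arguments.
Unset Strict Implicit.
Unset Printing Implicit Defensive.

(** * A smooth convex potential on the line *)

Section Huber.
Variable R : realType.
Implicit Types u v : R.

Definition clamp01 u : R := Num.max 0 (Num.min u 1).

(* The maximum of [h * u - h ^+ 2 / 2] over [h] in [0, 1], whence its derivative is
   [clamp01]. *)
Definition huber u : R := clamp01 u * u - clamp01 u ^+ 2 / 2.

Variant clamp01_spec u : R -> Prop :=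
| ClampLow of u <= 0 : clamp01_spec u 0
| ClampMid of 0 <= u & u <= 1 : clamp01_spec u u
| ClampHigh of 1 <= u : clamp01_spec u 1.

Lemma clamp01P u : clamp01_spec u (clamp01 u).
Proof.
rewrite /clamp01; case: (leP u 1) => u1; case: leP => u0.
- by constructor.
- by constructor; exact: ltW.
- by constructor; exact: ltW.
- by move: u0; rewrite ltNge ler01.
Qed.

Lemma clamp01_ge0 u : 0 <= clamp01 u.
Proof. by case: clamp01P. Qed.

Lemma clamp01_le1 u : clamp01 u <= 1.
Proof. by case: clamp01P. Qed.

Lemma huber_ge0 u : 0 <= huber u.
Proof. rewrite /huber; case: clamp01P; nra. Qed.

(** With [h] and [h'] the maximizers at [u] and [u + v], the left side minus the right side is [(h'
    - h) * (u - h) - (h' - h - v) ^+ 2 / 2]. The first term is nonpositive by first-order optimality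
    of [h] on [0, 1]. *)
Lemma huber_smooth u v : huber (u + v) <= huber u + clamp01 u * v + v ^+ 2 / 2.
Proof.
rewrite /huber; set h' := clamp01 (u + v).
have h'0 : 0 <= h' := clamp01_ge0 _; have h'1 : h' <= 1 := clamp01_le1 _.
have opt : (h' - clamp01 u) * (u - clamp01 u) <= 0 by case: clamp01P; nra.
set h := clamp01 u in opt *.
have sq : 0 <= (h' - h - v) ^+ 2 by exact: sqr_ge0.
nra.
Qed.

End Huber.

(** * Near-minimizers of the penalized potential *)

Section NearMinimizer.
Variables (R : realType) (X : finType) (mu : fdist R X).
Variables (A : Type) (s : A -> X -> R) (c : A -> R) (lam g : R).
Hypothesis s_le1 : forall a x, `|s a x| <= 1.
Hypothesis c_ge0 : forall a, 0 <= c a.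
Hypothesis lam_ge0 : 0 <= lam.
Hypothesis g_gt0 : 0 < g.
Hypothesis g_le1 : g <= 1.

Implicit Types G : seq (R * A).

Definition comb G x : R := \sum_(p <- G) p.1 * s p.2 x.
Definition comb_cost G : R := \sum_(p <- G) p.1 * c p.2.
Definition comb_weight G : R := \sum_(p <- G) p.1.
Definition nneg_comb G := all (fun p => 0 <= p.1) G.

Let pen G := lam * comb_cost G + g * comb_weight G.
Let pot G := \sum_x mu x * huber (1 - comb G x) + pen G.

Lemma sum_fdist_const (a : R) : \sum_x mu x * a = a.
Proof. by rewrite -mulr_suml pmf_sum1 mul1r. Qed.

Lemma sum_fdist_le (F G : X -> R) :
  (forall x, F x <= G x) -> \sum_x mu x * F x <= \sum_x mu x * G x.
Proof. by move=> FG; apply: ler_sum => x _; rewrite ler_wpM2l ?Defs.pmf_ge0. Qed.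

Lemma nneg_comb_le G (F F' : A -> R) : nneg_comb G -> (forall a, F a <= F' a) ->
  \sum_(p <- G) p.1 * F p.2 <= \sum_(p <- G) p.1 * F' p.2.
Proof.
move=> + FF'; elim: G => [|p G IH /= /andP[p0 G0]]; first by rewrite !big_nil.
by rewrite !big_cons lerD ?IH // ler_wpM2l.
Qed.

Lemma nneg_comb_ge0 G (F : A -> R) : nneg_comb G -> (forall a, 0 <= F a) ->
  0 <= \sum_(p <- G) p.1 * F p.2.
Proof.
move=> G0 F0; apply: le_trans (nneg_comb_le G0 F0).
by rewrite big1 // => p _; rewrite mulr0.
Qed.

Lemma comb_weightE G : comb_weight G = \sum_(p <- G) p.1 * 1.
Proof. by apply: eq_bigr => p _; rewrite mulr1. Qed.

Lemma comb_weight_ge0 G : nneg_comb G -> 0 <= comb_weight G.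
Proof. by move=> G0; rewrite comb_weightE (@nneg_comb_ge0 _ (fun=> 1)). Qed.

Lemma comb_norm_le G x : nneg_comb G -> `|comb G x| <= comb_weight G.
Proof.
move=> G0; rewrite ler_norml comb_weightE -sumrN; apply/andP; split.
  under eq_bigr do rewrite -mulrN.
  apply: (@nneg_comb_le _ (fun=> -1) (s^~ x)) => // a.
  by case/ler_normlP: (s_le1 a x) => *; lra.
apply: (@nneg_comb_le _ (s^~ x) (fun=> 1)) => // a.
by case/ler_normlP: (s_le1 a x) => *; lra.
Qed.

Let pen_ge0 G : nneg_comb G -> g * comb_weight G <= pen G.
Proof. by move=> G0; rewrite lerDr mulr_ge0 // nneg_comb_ge0. Qed.

Let pot_ge0 G : nneg_comb G -> 0 <= pot G.
Proof.
move=> G0; rewrite addr_ge0 //.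
  by apply: sumr_ge0 => x _; rewrite mulr_ge0 ?Defs.pmf_ge0 ?huber_ge0.
by apply: le_trans (pen_ge0 G0); rewrite mulr_ge0 ?comb_weight_ge0 // ltW.
Qed.

Let pot_nil : pot [::] <= 1 / 2.
Proof.
rewrite /pot /pen /comb_cost /comb_weight /comb !big_nil !mulr0 !addr0.
rewrite (eq_bigr (fun x => mu x * (1 / 2))) ?sum_fdist_const //.
move=> x _; rewrite big_nil subr0 /huber; congr (_ * _).
by case: clamp01P => h; lra.
Qed.

Let pot_smooth G G' (d : X -> R) (B : R) :
    (forall x, comb G' x = comb G x + d x) -> (forall x, d x ^+ 2 <= B) ->
  pot G' <= pot G - \sum_x mu x * (clamp01 (1 - comb G x) * d x)
            + B / 2 + (pen G' - pen G).
Proof.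
move=> G'E dB.
set S := \sum_x _.
suff : \sum_x mu x * huber (1 - comb G' x) <=
       \sum_x mu x * huber (1 - comb G x) - S + B / 2 by rewrite /pot; lra.
rewrite -[B / 2]sum_fdist_const -sumrB -big_split /=.
rewrite [leRHS](_ : _ = \sum_x mu x * (huber (1 - comb G x)
                  + clamp01 (1 - comb G x) * (- d x) + B / 2)); last first.
  by apply: eq_bigr => x _; ring.
apply: sum_fdist_le => x; rewrite G'E opprD addrA.
apply: (le_trans (huber_smooth _ _)).
by rewrite lerD2l ler_wpM2r ?invr_ge0 // sqrrN.
Qed.

(* [H] is minus the derivative of the potential, so the two bounds are the
   first-order conditions at an almost-minimizer, in the directions [s a] and
   [- G]. *)
Lemma near_minimizer : exists G, let H x := clamp01 (1 - comb G x) in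
  [/\ nneg_comb G,
      forall a, \sum_x mu x * (H x * s a x) <= lam * c a + 5 / 2 * g &
      lam * comb_cost G + g * comb_weight G <=
        \sum_x mu x * (H x * comb G x) + 3 / 2 * g].
Proof.
pose E := [set pot G | G in [set G | nneg_comb G]]%classic.
have Elb : has_inf E.
  split; first by exists (pot [::]), [::].
  by exists 0 => _ [G /= G0 <-]; exact: pot_ge0.
have infE G : nneg_comb G -> inf E <= pot G.
  by move=> G0; apply: ge_inf; [case: Elb|exists G].
(* Step length of both perturbations. The slack [t ^+ 2 / 2] and the second-order terms, at most
   [t ^+ 2] and [t ^+ 2 / g ^+ 2 = t * g], cost O(g) after division by [t]. *)
set t := g ^+ 3.
have t0 : 0 < t by rewrite exprn_gt0.
have tg : t <= g by rewrite /t -[leRHS]expr1 ler_wiXn2l // ltW.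
have tg2 : t <= g ^+ 2 by rewrite /t ler_wiXn2l // ltW.
have tt0 : 0 < t ^+ 2 / 2 by rewrite divr_gt0 // exprn_gt0.
have [_ [G /= G0 <-] Gt] := inf_adherent tt0 Elb.
have t1 : t ^+ 2 <= 1 by apply: exprn_ile1; [exact: ltW | exact: le_trans g_le1].
have W0 := comb_weight_ge0 G0.
(* Comparison with the empty combination, whose potential is at most 1/2. *)
have W1 : g * comb_weight G <= 1.
  have : inf E <= 1 / 2 by apply: le_trans pot_nil; exact: infE.
  have : pen G <= pot G.
    by rewrite lerDr sumr_ge0 // => x _; rewrite mulr_ge0 ?Defs.pmf_ge0 ?huber_ge0.
  have := pen_ge0 G0; lra.
exists G; split=> //.
- move=> a; set G' := (t, a) :: G.
  have G'0 : nneg_comb G' by rewrite /nneg_comb /= ltW.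
  have inf_le := infE _ G'0.
  have d1 x : comb G' x = comb G x + t * s a x by rewrite /comb big_cons addrC.
  have d2 x : (t * s a x) ^+ 2 <= t ^+ 2.
    have := s_le1 a x; rewrite ler_norml exprMn => /andP[? ?].
    by rewrite ler_piMr ?sqr_ge0 //; nra.
  have := pot_smooth d1 d2.
  have -> : pen G' - pen G = t * (lam * c a + g).
    by rewrite /pen /comb_cost /comb_weight !big_cons /=; ring.
  have -> : \sum_x mu x * (clamp01 (1 - comb G x) * (t * s a x)) =
            t * \sum_x mu x * (clamp01 (1 - comb G x) * s a x).
    by rewrite mulr_sumr; apply: eq_bigr => x _; ring.
  set S := \sum_x _ => smooth.
  rewrite -(ler_pM2l t0); apply: le_trans (_ : t * (lam * c a + g + 3 / 2 * t) <= _).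
    nra.
  by rewrite ler_pM2l //; lra.
- set G' : seq (R * A) := [seq ((1 - t) * p.1, p.2) | p <- G].
  have G'0 : nneg_comb G'.
    rewrite /nneg_comb all_map; apply: sub_all G0 => p /= p0.
    by rewrite mulr_ge0 // subr_ge0 (le_trans tg).
  have G'E F : \sum_(p <- G') p.1 * F p.2 = (1 - t) * \sum_(p <- G) p.1 * F p.2.
    by rewrite big_map mulr_sumr; apply: eq_bigr => p _; rewrite mulrA.
  have inf_le := infE _ G'0.
  have d1 x : comb G' x = comb G x + - (t * comb G x).
    by rewrite /comb (G'E (s^~ x)); ring.
  have d2 x : (- (t * comb G x)) ^+ 2 <= t * g.
    have gG : g * `|comb G x| <= 1.
      by apply: le_trans W1; rewrite ler_pM2l // comb_norm_le.
    have -> : (- (t * comb G x)) ^+ 2 = t * g * (g * `|comb G x|) ^+ 2.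
      by rewrite sqrrN !exprMn real_normK ?num_real // /t; ring.
    rewrite ler_piMr ?(mulr_ge0 (ltW t0) (ltW g_gt0)) // exprn_ile1 //.
    by rewrite mulr_ge0 // ltW.
  have := pot_smooth d1 d2.
  have -> : pen G' - pen G = - (t * pen G).
    have wE : comb_weight G' = (1 - t) * comb_weight G.
      by rewrite /comb_weight big_map mulr_sumr.
    by rewrite /pen /comb_cost G'E wE; ring.
  have -> : \sum_x mu x * (clamp01 (1 - comb G x) * - (t * comb G x)) =
            - (t * \sum_x mu x * (clamp01 (1 - comb G x) * comb G x)).
    by rewrite mulr_sumr -sumrN; apply: eq_bigr => x _; ring.
  set S := \sum_x _; rewrite -/(pen G) => smooth.
  rewrite -(ler_pM2l t0); nra.
Qed.

End NearMinimizer.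

(** * Derandomized sampling from a weighted combination *)

Section Sampling.
Variables (R : realType) (X : finType) (A : Type) (s : A -> X -> R) (c : A -> R).
Hypothesis s_le1 : forall a x, `|s a x| <= 1.
Variable G : seq (R * A).
Hypothesis G_ge0 : nneg_comb G.
Hypothesis W_gt0 : 0 < comb_weight G.

Lemma exists_le_average (F : A -> R) (C : R) :
  \sum_(p <- G) p.1 * F p.2 <= C * comb_weight G -> exists a, F a <= C.
Proof.
apply: contraPP => /forallNP FC; apply/negP; rewrite -ltNge.
have {}FC a : C < F a by rewrite ltNge; apply/negP.
elim: G G_ge0 W_gt0 => [|p G' IH /= /andP[p0 G'0]].
  by rewrite /comb_weight !big_nil ltxx.
rewrite /comb_weight !big_cons mulrDr.
have [->|pn0 _] := eqVneq p.1 0; first by rewrite mulr0 mul0r !add0r; exact: IH.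
rewrite ltr_leD //; first by rewrite mulrC ltr_pM2l // lt0r pn0.
rewrite mulr_sumr; under [leLHS]eq_bigr do rewrite mulrC.
by apply: (@nneg_comb_le _ _ _ (fun=> C)) => // a; exact: ltW.
Qed.

(* Derandomized sampling: the members of [G] are drawn one at a time, each
   chosen so that the conditional expectation does not increase. *)
Lemma greedy_sample (sigma alpha kappa B : R) (t : nat) (w : X -> R) :
    0 <= sigma <= 1 -> 0 <= 1 - sigma * alpha -> 0 <= kappa ->
    (forall x, 0 <= w x) ->
    (forall x, w x != 0 -> alpha * comb_weight G <= comb s G x) ->
  exists S : seq A, size S = t /\
    kappa * (\sum_x w x * \prod_(a <- S) (1 - sigma * s a x))
      + B * (\sum_(a <- S) c a)
    <= kappa * ((1 - sigma * alpha) ^+ t * \sum_x w x)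
       + B * (t%:R * (comb_cost c G / comb_weight G)).
Proof.
move=> /andP[sg0 sg1] beta0 kappa0.
set beta := 1 - sigma * alpha in beta0 *; set cbar := _ / _.
elim: t w => [|t IH] w w0 wG.
  exists [::]; split=> //; rewrite big_nil mul0r !mulr0 !addr0 expr0 mul1r.
  by under eq_bigr do rewrite big_nil mulr1.
have [a aP] : exists a, kappa * beta ^+ t * (\sum_x w x * (1 - sigma * s a x))
    + B * c a <= kappa * beta ^+ t * (beta * \sum_x w x) + B * cbar.
  apply: exists_le_average.
  have -> : \sum_(p <- G) p.1 * (kappa * beta ^+ t *
        (\sum_x w x * (1 - sigma * s p.2 x)) + B * c p.2) =
      kappa * beta ^+ t * (\sum_x w x * (comb_weight G - sigma * comb s G x))
      + B * comb_cost c G.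
    under eq_bigr do rewrite mulrDr; rewrite big_split /=; congr (_ + _).
      under eq_bigr do rewrite mulrCA mulr_sumr.
      rewrite -mulr_sumr exchange_big /=; congr (_ * _); apply: eq_bigr => x _.
      rewrite /comb_weight /comb mulr_sumr -sumrB mulr_sumr.
      by apply: eq_bigr => p _; ring.
    by rewrite mulr_sumr; apply: eq_bigr => p _; rewrite mulrCA.
  have -> : (kappa * beta ^+ t * (beta * \sum_x w x) + B * cbar) * comb_weight G
      = kappa * beta ^+ t * (\sum_x w x * (beta * comb_weight G)) + B * comb_cost c G.
    by rewrite -mulr_suml /cbar; field; rewrite gt_eqF.
  rewrite lerD2r ler_wpM2l ?mulr_ge0 ?exprn_ge0 //; apply: ler_sum => x _.
  have [->|/wG le_x] := eqVneq (w x) 0; first by rewrite !mul0r.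
  rewrite ler_wpM2l // /beta mulrBl mul1r lerD2l lerN2 -mulrA.
  by rewrite ler_wpM2l.
(* The chosen factor is absorbed into the weights; their support does not grow, so the margin
   hypothesis persists. *)
have [||S [St SP]] := IH (fun x => w x * (1 - sigma * s a x)).
- move=> x; rewrite mulr_ge0 // subr_ge0.
  by case/ler_normlP: (s_le1 a x) => *; nra.
- by move=> x; rewrite mulf_eq0 negb_or => /andP[/wG].
exists (a :: S); split; first by rewrite /= St.
rewrite big_cons mulrDr.
rewrite [X in kappa * X](eq_bigr (fun x => w x * (1 - sigma * s a x) *
   \prod_(b <- S) (1 - sigma * s b x))); last by move=> x _; rewrite big_cons mulrA.
rewrite -natr1 exprSr.
set S1 := \sum_x _ in SP *; set S2 := \sum_x _ in aP SP *.
set S3 := \sum_x _ in aP *.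
have -> : beta ^+ t * beta * S3 = beta ^+ t * (beta * S3) by ring.
move: aP SP; rewrite -!mulrA; set K := beta ^+ t * _; set K' := beta ^+ t * _.
rewrite !mulrDl !mulrDr mul1r; lra.
Qed.

End Sampling.

(** * Sequential composition of trees and majority votes *)

Section Trees.
Variable I : finType.

Fixpoint dtree_bind (L L' : pointedType) (T : dtree I L) (k : L -> dtree I L') :
    dtree I L' :=
  match T with
  | Leaf l => k l
  | Query i T0 T1 => Query i (dtree_bind T0 k) (dtree_bind T1 k)
  end.

Lemma dtree_bind_eval (L L' : pointedType) (T : dtree I L) (k : L -> dtree I L') x :
  dtree_eval (dtree_bind T k) x = dtree_eval (k (dtree_eval T x)) x.
Proof. by elim: T => //= i T0 IH0 T1 IH1; case: ifP. Qed.

Lemma dtree_bind_queried (L L' : pointedType) (T : dtree I L) (k : L -> dtree I L') x :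
  queried (dtree_bind T k) x = (queried T x :|: queried (k (dtree_eval T x)) x)%SET.
Proof.
elim: T => [l|i T0 IH0 T1 IH1] /=; first by rewrite finset.set0U.
by case: ifP; rewrite -finset.setUA ?IH0 ?IH1.
Qed.

Fixpoint dtree_seq (L L' : pointedType) (S : seq (dtree I L)) (g : seq L -> L') :
    dtree I L' :=
  match S with
  | [::] => Leaf (g [::])
  | T :: S' => dtree_bind T (fun l => dtree_seq S' (fun ls => g (l :: ls)))
  end.

Lemma dtree_seq_eval (L L' : pointedType) (S : seq (dtree I L)) (g : seq L -> L') x :
  dtree_eval (dtree_seq S g) x = g [seq dtree_eval T x | T <- S].
Proof. by elim: S g => //= T S IH g; rewrite dtree_bind_eval IH. Qed.

Lemma dtree_seq_queried (L L' : pointedType) (S : seq (dtree I L)) (g : seq L -> L') x :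
  (#|queried (dtree_seq S g) x| <= \sum_(T <- S) #|queried T x|)%N.
Proof.
elim: S g => [|T S IH] g /=; first by rewrite finset.cards0.
rewrite big_cons dtree_bind_queried.
by apply: (leq_trans (leq_card_setU _ _)); rewrite leq_add2l.
Qed.

Variables (R : realType) (mu : fdist R (cube I)).

Lemma dtree_depth_ge0 (L : pointedType) (T : dtree I L) : 0 <= dtree_depth mu T.
Proof. by apply: sumr_ge0 => x _; rewrite mulr_ge0 ?Defs.pmf_ge0. Qed.

Lemma dtree_seq_depth (L L' : pointedType) (S : seq (dtree I L)) (g : seq L -> L') :
  dtree_depth mu (dtree_seq S g) <= \sum_(T <- S) dtree_depth mu T.
Proof.
rewrite exchange_big /=; apply: ler_sum => x _; rewrite -mulr_sumr.
by rewrite ler_wpM2l ?Defs.pmf_ge0 // -natr_sum ler_nat dtree_seq_queried.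
Qed.

Definition dtree_error (L : pointedType) (g : cube I -> L) (T : dtree I L) : R :=
  \sum_x mu x * (dtree_eval T x != g x)%:R.

Definition agree (f : cube I -> pm1) (T : dtree I pm1) (x : cube I) : R :=
  if dtree_eval T x == f x then 1 else -1.

Definition majority (ls : seq bool) : bool := (count negb ls < count id ls)%N.

(** The inequality is weak because a tie is decided as [false], possibly wrongly. *)
Lemma majority_wrong (ls : seq bool) (b : bool) : majority ls != b ->
  (count (pred1 b) ls <= count (predC (pred1 b)) ls)%N.
Proof.
rewrite /majority; case: b => maj.
  have -> : count (pred1 true) ls = count id ls by apply: eq_count => -[].
  rewrite (@eq_count _ (predC (pred1 true)) negb); last by case=> /=.
  by move: maj; rewrite eqb_id -leqNgt.
have -> : count (pred1 false) ls = count negb ls by apply: eq_count => -[].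
rewrite (@eq_count _ (predC (pred1 false)) id); last by case=> /=.
by move: maj; rewrite eqbF_neg negbK => /ltnW.
Qed.

(* When the majority is wrong, the factors [1 - sigma] and [1 + sigma] can be
   paired off, leaving only factors [1 + sigma]. *)
Lemma majority_prod (f : cube I -> pm1) (S : seq (dtree I pm1)) (sigma : R) x :
    0 <= sigma <= 1 -> dtree_eval (dtree_seq S majority) x != f x ->
  (1 - sigma ^+ 2) ^+ size S <= \prod_(T <- S) (1 - sigma * agree f T x).
Proof.
move=> /andP[sg0 sg1]; rewrite dtree_seq_eval => /majority_wrong.
set ls := map _ _; set r := count _ _; set w := count _ _ => rw.
have -> : \prod_(T <- S) (1 - sigma * agree f T x) =
          (1 - sigma) ^+ r * (1 + sigma) ^+ w.
  rewrite /r /w /ls; elim: S {ls r w rw} => [|T S IH] /=.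
    by rewrite big_nil !expr0 mulr1.
  rewrite big_cons IH /agree; case: eqP => _ /=; rewrite ?add0n ?add1n exprS; ring.
have rS : (r <= size S)%N by rewrite /r (leq_trans (count_size _ _)) // size_map.
have sq0 : 0 <= 1 - sigma ^+ 2 by rewrite subr_ge0 exprn_ile1.
apply: (@le_trans _ _ ((1 - sigma ^+ 2) ^+ r)).
  by rewrite ler_wiXn2l // gerBl sqr_ge0.
have -> : 1 - sigma ^+ 2 = (1 - sigma) * (1 + sigma) by ring.
rewrite exprMn ler_wpM2l ?exprn_ge0 ?subr_ge0 //.
by rewrite ler_weXn2l // lerDl.
Qed.

End Trees.

(** Keeps [ln (1 / delta)] above 1/2 when [delta <= 1 / 2]. *)
Lemma ln_inv_ge (R : realType) (x : R) : 0 < x -> 1 - x <= ln (1 / x).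
Proof.
move=> x0; rewrite div1r lnV ?posrE //.
suff : ln x <= x - 1 by lra.
have -> : ln x = ln (1 + (x - 1)) by congr ln; ring.
by apply: le_ln1Dx; lra.
Qed.

(** * Boosting and the existence of hardcore measures *)

Section Hardcore.
Variables (R : realType) (I : finType) (mu : fdist R (cube I)) (f : cube I -> pm1).

Lemma agree_norm T x : `|agree R f T x| <= 1.
Proof. by rewrite /agree; case: eqP; rewrite ?normrN normr1. Qed.

(* With [alpha = 1 / (2 * comb_weight G)], every input outside the exceptional set
   has margin at least [alpha] under the normalized [G]; about
   [ln (1 / delta) / alpha ^+ 2] samples bring the weight of those on which the
   majority is wrong down to [delta / 2]. *)
Lemma boost (G : seq (R * dtree I pm1)) (delta D : R) :
    0 < delta <= 1 / 2 -> 0 < D -> nneg_comb G -> 1 / 2 <= comb_weight G ->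
    56 * ln (1 / delta) * (comb_weight G * comb_cost (dtree_depth mu) G) <= D / 4 ->
    \sum_x mu x * (comb (agree R f) G x < 1 / 2)%R%:R <= delta / 2 ->
  exists2 T : dtree I pm1, dtree_error mu f T <= delta & dtree_depth mu T < D.
Proof.
move=> /andP[d0 d1] D0 G0 W1 costG bad.
set L := ln _ in costG; set W := comb_weight G in W1 costG.
have L1 : 1 / 2 <= L by apply: le_trans (ln_inv_ge d0); lra.
have W0 : 0 < W by lra.
have Wn0 : W != 0 by rewrite gt_eqF.
pose alpha := 1 / (2 * W).
have alphaW : alpha * W = 1 / 2 by rewrite /alpha; field.
have a0 : 0 < alpha by rewrite /alpha divr_gt0 ?mulr_gt0.
have a1 : alpha <= 1 by nra.
(* This makes [beta = 1 - 2 * sigma ^+ 2] at most [q ^+ 2]. Sampling brings the weighted product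
   down to order [beta ^+ t], while a wrong majority keeps it above [q ^+ t], so the wrong weight is
   of order [q ^+ t]. *)
pose sigma := alpha / 2.
have sg0 : 0 < sigma by rewrite /sigma; lra.
have sg1 : sigma <= 1 / 2 by rewrite /sigma; lra.
have y0 : 0 <= 12 * L / alpha ^+ 2.
  by rewrite divr_ge0 ?sqr_ge0 // mulr_ge0 //; lra.
(* The factor 12 gives [q ^+ t <= expR (- (3 * L)) = delta ^+ 3 <= delta / 3]. Rounding up raises it
   to 14, which becomes 56 in the cost since [alpha ^- 2 = 4 * W ^+ 2]. *)
have [t [t_gt t_le]] : exists t : nat,
    12 * L / alpha ^+ 2 < t%:R /\ t%:R <= 14 * L / alpha ^+ 2.
  have /andP[t_le t_gt] := truncn_itv y0.
  exists (Num.truncn (12 * L / alpha ^+ 2)).+1; split=> //.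
  rewrite -natr1; apply: (@le_trans _ _ (12 * L / alpha ^+ 2 + 1)).
    by rewrite lerD2r.
  have : 1 <= 2 * L / alpha ^+ 2.
    by rewrite ler_pdivlMr ?exprn_gt0 // mul1r; nra.
  by rewrite -!mulrA; set u := L / _; lra.
have t_ln : ln (3 / delta) <= 3 * L.
  have -> : 3 * L = ln ((1 / delta) ^+ 3) by rewrite lnXn ?divr_gt0 // mulr_natl.
  rewrite ler_ln ?posrE ?exprn_gt0 ?divr_gt0 //.
  have u2 : 2 <= 1 / delta by rewrite ler_pdivlMr //; lra.
  have -> : 3 / delta = 3 * (1 / delta) by rewrite mul1r.
  by move: (1 / delta) u2 => u u2; rewrite exprSr ler_wpM2r //; nra.
pose beta := 1 - sigma * alpha.
have b0 : 0 < beta by rewrite /beta; nra.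
pose w x : R := mu x * (1 / 2 <= comb (agree R f) G x)%R%:R.
(* These [kappa] and [B] bound the combined quantity by 1 + 1/2, which controls the product and the
   cost at once: the latter is at most [3 / 4 * D]. *)
have [|||||S [St SP]] := @greedy_sample R _ _ (agree R f) (dtree_depth mu) agree_norm G G0
   W0 sigma alpha (beta ^- t) (2 / D) t w.
- by apply/andP; split; lra.
- exact: ltW.
- by rewrite invr_ge0 exprn_ge0 // ltW.
- by move=> x; rewrite mulr_ge0 ?Defs.pmf_ge0.
- by move=> x; rewrite /w alphaW; case: (1 / 2 <= _)%R; rewrite ?mulr0 ?eqxx.
pose q := 1 - sigma ^+ 2.
have q0 : 0 < q.
  have -> : q = (1 - sigma) * (1 + sigma) by rewrite /q; ring.
  by rewrite mulr_gt0 //; lra.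
have bq : beta <= q ^+ 2.
  have -> : q ^+ 2 = beta + (alpha ^+ 2 / 4) ^+ 2 by rewrite /q /beta /sigma; field.
  by rewrite lerDl sqr_ge0.
have bt0 : 0 < beta ^+ t by rewrite exprn_gt0.
have w1 : \sum_x w x <= 1.
  rewrite -(pmf_sum1 mu); apply: ler_sum => x _.
  by rewrite /w; case: (1 / 2 <= _)%R; rewrite ?mulr1 // mulr0 Defs.pmf_ge0.
have cost_t : t%:R * (comb_cost (dtree_depth mu) G / W) <= D / 4.
  apply: le_trans costG.
  apply: (@le_trans _ _ (14 * L / alpha ^+ 2 * (comb_cost (dtree_depth mu) G / W))).
    rewrite ler_wpM2r // divr_ge0 ?(ltW W0) //; apply: nneg_comb_ge0 => // T.
    exact: dtree_depth_ge0.
  by rewrite le_eqVlt; apply/orP; left; apply/eqP; rewrite /alpha; field.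
move: SP; rewrite -/beta (mulKf (lt0r_neq0 bt0)).
set P := \sum_x _; set C := \sum_(T <- S) _; set tc := t%:R * _ in cost_t * => SP.
have P0 : 0 <= P.
  apply: sumr_ge0 => x _; rewrite mulr_ge0 ?mulr_ge0 ?Defs.pmf_ge0 //.
  apply: prodr_ge0 => T _; case/ler_normlP: (agree_norm T x) => *; nra.
have C0 : 0 <= C by apply: sumr_ge0 => T _; exact: dtree_depth_ge0.
have Dtc : 2 / D * tc <= 1 / 2 by rewrite mulrAC ler_pdivrMr //; lra.
have DC0 : 0 <= 2 / D * C by rewrite mulr_ge0 // divr_ge0 // ltW.
have bP0 : 0 <= beta ^- t * P by rewrite mulr_ge0 // invr_ge0 ltW.
exists (dtree_seq S majority); last first.
  apply: (le_lt_trans (dtree_seq_depth _ _ _)).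
  have : 2 / D * C <= 3 / 2 by lra.
  by rewrite mulrAC ler_pdivrMr // -/C; lra.
have Pt : P <= 3 / 2 * q ^+ t * q ^+ t.
  have : beta ^- t * P <= 3 / 2 by lra.
  rewrite mulrC ler_pdivrMr // => h; apply: (le_trans h).
  rewrite -mulrA ler_pM2l // -exprMn -expr2.
  by rewrite lerXn2r ?nnegrE ?exprn_ge0 ?(ltW b0) ?(ltW q0).
have qt : 3 / 2 * q ^+ t <= delta / 2.
  suff : q ^+ t <= delta / 3 by lra.
  have -> : delta / 3 = expR (- ln (3 / delta)).
    by rewrite expRN lnK ?posrE ?divr_gt0 // invf_div.
  apply: (@le_trans _ _ (expR (- (sigma ^+ 2)) ^+ t)).
    by rewrite lerXn2r ?nnegrE ?expR_ge0 ?(ltW q0) // expR_ge1Dx.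
  rewrite -expRM_natl ler_expR mulrN lerN2; apply: (le_trans t_ln).
  move: t_gt; rewrite ltr_pdivrMr ?exprn_gt0 // /sigma; lra.
pose T := dtree_seq S majority; rewrite -/T.
have errP : q ^+ t * \sum_x w x * (dtree_eval T x != f x)%R%:R <= P.
  rewrite mulr_sumr; apply: ler_sum => x _.
  rewrite mulrCA ler_wpM2l ?mulr_ge0 ?Defs.pmf_ge0 //.
  case: (boolP (_ != _)) => [wrong|_].
    by rewrite mulr1 -St; apply: majority_prod wrong; lra.
  rewrite mulr0; apply: prodr_ge0 => T' _.
  by case/ler_normlP: (agree_norm T' x) => *; nra.
have : \sum_x w x * (dtree_eval T x != f x)%R%:R <= delta / 2.
  apply: le_trans qt; rewrite -(ler_pM2l (exprn_gt0 t q0)).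
  by apply: (le_trans errP); rewrite [leRHS]mulrC.
suff : dtree_error mu f T <= \sum_x mu x * (comb (agree R f) G x < 1 / 2)%R%:R +
   \sum_x w x * (dtree_eval T x != f x)%R%:R by lra.
rewrite -big_split /=; apply: ler_sum => x _; rewrite /w -mulrA -mulrDr.
rewrite ler_wpM2l ?Defs.pmf_ge0 //; clear; case: leP; case: (_ == _) => /=; lra.
Qed.

Lemma hardcore (gamma delta D : R) : 0 < gamma < 1 -> 0 < delta <= 1 / 2 -> 0 < D ->
    (forall T : dtree I pm1, dtree_error mu f T <= delta -> D <= dtree_depth mu T) ->
  exists H : cube I -> R, [/\ forall x, 0 <= H x <= 1,
    delta / 4 <= \sum_x mu x * H x &
    forall T, \sum_x mu x * (H x * agree R f T x) <=
      224 * ln (1 / delta) * delta / (gamma * D) * dtree_depth mu T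
      + 5 / 2 * (gamma * delta)].
Proof.
move=> /andP[g0 g1] d01 D0 hard; have /andP[d0 d1] := d01.
set L := ln _; have L1 : 1 / 2 <= L by apply: le_trans (ln_inv_ge d0); lra.
(* Tuned so that, if [H] had density below [delta / 4], the budget [pen2] and the AM-GM inequality
   would give exactly the cost hypothesis of [boost]. *)
set lam := 224 * L * delta / (gamma * D).
have lam0 : 0 < lam by rewrite /lam divr_gt0 ?mulr_gt0 //; lra.
have gd0 : 0 < gamma * delta by rewrite mulr_gt0.
have gd1 : gamma * delta <= 1 by nra.
have [G [G0 GT Gpen]] := near_minimizer mu agree_norm (@dtree_depth_ge0 _ _ mu _)
  (ltW lam0) gd0 gd1.
pose H x := clamp01 (1 - comb (agree R f) G x).
exists H; split=> //; first by move=> x; rewrite clamp01_ge0 clamp01_le1.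
rewrite leNgt; apply/negP => H_small.
(* [H] vanishes wherever the combination exceeds 1. *)
have HG : \sum_x mu x * (H x * comb (agree R f) G x) <= \sum_x mu x * H x.
  by apply: sum_fdist_le => x; rewrite /H; case: clamp01P; nra.
(* Markov's inequality: [H] exceeds 1/2 wherever the combination is below 1/2. *)
have bad : \sum_x mu x * (comb (agree R f) G x < 1 / 2)%R%:R <= delta / 2.
  apply: (@le_trans _ _ (\sum_x mu x * (2 * H x))).
    apply: sum_fdist_le => x; rewrite /H; case: ltP; case: clamp01P => /=; lra.
  under eq_bigr do rewrite mulrCA.
  by rewrite -mulr_sumr; lra.
(* A smaller weight would make every input bad, with total measure 1. *)
have W1 : 1 / 2 <= comb_weight G.
  rewrite leNgt; apply/negP => W1; move: bad.
  rewrite (eq_bigr (fun x => mu x * 1)) ?sum_fdist_const => [|x _]; first by lra.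
  have := comb_norm_le agree_norm x G0.
  by rewrite ler_norml => /andP[_ le]; rewrite (le_lt_trans le).
set W := comb_weight G in W1 Gpen; set C := comb_cost _ G in Gpen.
have C0 : 0 <= C by apply: nneg_comb_ge0 => // T; exact: dtree_depth_ge0.
have pen2 : lam * C + gamma * delta * W <= 2 * delta by nra.
have amgm : lam * C * (gamma * delta * W) <= delta ^+ 2.
  have lC : 0 <= lam * C by rewrite mulr_ge0 // ltW.
  have gW : 0 <= gamma * delta * W by rewrite mulr_ge0 //; lra.
  have := sqr_ge0 (lam * C - gamma * delta * W); nra.
have costG : 56 * L * (W * C) <= D / 4.
  have -> : 56 * L * (W * C) = lam * C * (gamma * delta * W) * (D / (4 * delta ^+ 2)).
    by rewrite /lam; field; rewrite !gt_eqF.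
  have -> : D / 4 = delta ^+ 2 * (D / (4 * delta ^+ 2)) by field; rewrite gt_eqF.
  by rewrite ler_wpM2r // divr_ge0 ?mulr_ge0 ?sqr_ge0 ?ltW.
have [T /hard DT] := boost d01 D0 G0 W1 costG bad.
by rewrite ltNge DT.
Qed.

End Hardcore.

(** * Success probability at a single leaf *)

(** After normalization by [m], the left product is at most [expR (- \sum_i (D i - A i) / 2)]. If
    the total correlation is at most [p], it costs a factor [expR (p / 2)]; otherwise the product is
    at most 1, hence at most that total over [p]. The unnormalized form lets the bounds be added
    over the leaves. *)
Lemma leaf_bound (R : realType) (I : finType) (p : R) (m h a : I -> R) :
    0 < p -> (forall i, 0 <= a i <= h i) -> (forall i, h i <= m i) ->
  \prod_i (m i - (h i - a i) / 2) <=
    expR (p / 2) * \prod_i (m i - h i / 4)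
    + p^-1 * \sum_i a i * \prod_(j | j != i) m j.
Proof.
move=> p0 ah hm.
have a0 i : 0 <= a i by case/andP: (ah i).
have ha i : a i <= h i by case/andP: (ah i).
have m0 i : 0 <= m i by rewrite (le_trans (a0 i)) // (le_trans (ha i)).
(* A block of mass zero makes the left side vanish and cannot be normalized. *)
have [/existsP[i /eqP mi]|/existsPn mn0] := boolP [exists i, m i == 0].
  rewrite (bigD1 i) //= [X in X * _](_ : _ = 0) ?mul0r; last first.
    by have := a0 i; have := ha i; have := hm i; rewrite mi; lra.
  rewrite addr_ge0 ?mulr_ge0 ?expR_ge0 ?invr_ge0 ?(ltW p0) //.
    by apply: prodr_ge0 => j _; have := a0 j; have := ha j; have := hm j; lra.
  by apply: sumr_ge0 => j _; rewrite mulr_ge0 ?prodr_ge0.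
have {mn0}m_gt0 i : 0 < m i by rewrite lt0r mn0 m0.
have mn0 i : m i != 0 by rewrite gt_eqF.
pose D i := h i / m i; pose A i := a i / m i.
have A0 i : 0 <= A i by rewrite /A divr_ge0.
have AD i : A i <= D i by rewrite /A /D ler_wpM2r ?invr_ge0.
have D1 i : D i <= 1 by rewrite /D ler_pdivrMr // mul1r.
have -> : \prod_i (m i - (h i - a i) / 2) =
          \prod_i m i * \prod_i (1 - (D i - A i) / 2).
  by rewrite -big_split; apply: eq_bigr => i _ /=; rewrite /D /A; field.
have -> : \prod_i (m i - h i / 4) = \prod_i m i * \prod_i (1 - D i / 4).
  by rewrite -big_split; apply: eq_bigr => i _ /=; rewrite /D; field.
have -> : \sum_i a i * \prod_(j | j != i) m j = \prod_i m i * \sum_i A i.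
  rewrite mulr_sumr; apply: eq_bigr => i _.
  by rewrite [in RHS](bigD1 i) //= /A; field.
rewrite (mulrCA (expR _)) (mulrCA p^-1) -mulrDr ler_wpM2l ?prodr_ge0 //.
(* The weaker factor 1/4 leaves room for the reverse exponential inequality:
   [(1 + D i / 2) * (1 - D i / 4) >= 1] on [0, 1]. *)
have expD : expR (- (\sum_i D i / 2)) <= \prod_i (1 - D i / 4).
  rewrite -sumrN expR_sum; apply: ler_prod => i _; rewrite expR_ge0 /=.
  have D0 : 0 <= D i := le_trans (A0 i) (AD i).
  rewrite expRN -div1r ler_pdivrMr ?expR_gt0 //.
  have := D1 i; have := @expR_ge1Dx R (D i / 2); nra.
have expDA : \prod_i (1 - (D i - A i) / 2) <= expR (- (\sum_i (D i - A i) / 2)).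
  rewrite -sumrN expR_sum; apply: ler_prod => i _; apply/andP; split.
    by have := A0 i; have := AD i; have := D1 i; lra.
  exact: expR_ge1Dx.
apply: (le_trans expDA).
have sA0 : 0 <= \sum_i A i by apply: sumr_ge0.
have [Ap|pA] := leP (\sum_i A i) p.
  apply: (@le_trans _ _ (expR (p / 2) * expR (- (\sum_i D i / 2)))).
    rewrite -expRD ler_expR -!mulr_suml sumrB; lra.
  rewrite ler_wpDr ?mulr_ge0 ?invr_ge0 ?(ltW p0) //.
  by rewrite ler_wpM2l ?expR_ge0.
apply: (@le_trans _ _ 1).
  rewrite -[leRHS]expR0 ler_expR oppr_le0; apply: sumr_ge0 => i _.
  by have := AD i; lra.
rewrite ler_wpDl ?mulr_ge0 ?expR_ge0 //.
  by apply: prodr_ge0 => i _; have := D1 i; lra.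
by rewrite mulrC ler_pdivlMr // mul1r ltW.
Qed.

(** * Independence of the blocks and restriction of a tree to one block *)

Section Blocks.
Variables (n k : nat).
Local Notation index := ('I_k * 'I_n)%type.

Definition set_block (X : cube index) (i : 'I_k) (x : cube 'I_n) : cube index :=
  [ffun p => if p.1 == i then x p.2 else X p].

Lemma block_set_block X i x i' :
  block (set_block X i x) i' = if i' == i then x else block X i'.
Proof. by apply/ffunP => j; rewrite !ffunE /=; case: eqP; rewrite ?ffunE. Qed.

Lemma set_blockK X i x : set_block (set_block X i x) i (block X i) = X.
Proof. by apply/ffunP => -[i' j]; rewrite !ffunE /=; case: eqP => [->|]. Qed.

Lemma sum_prod_block (R : comNzRingType) (F : 'I_k -> cube 'I_n -> R) :
  \sum_(X : cube index) \prod_i F i (block X i) = \prod_i \sum_x F i x.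
Proof.
pose curry (X : cube index) : {ffun 'I_k -> cube 'I_n} := [ffun i => block X i].
pose uncurry (Y : {ffun 'I_k -> cube 'I_n}) : cube index := [ffun p => Y p.1 p.2].
have uK : cancel uncurry curry.
  by move=> Y; apply/ffunP => i; apply/ffunP => j; rewrite !ffunE.
have cK : cancel curry uncurry by move=> X; apply/ffunP => -[i j]; rewrite !ffunE.
rewrite bigA_distr_bigA (reindex uncurry) /=; last first.
  by exists curry => x _; [exact: uK|exact: cK].
apply: eq_bigr => Y _; apply: eq_bigr => i _; congr (F i _).
by rewrite -[in RHS](uK Y) ffunE.
Qed.

(** Turns a tree for the direct product into one for [f]: queries outside block [i] are answered
    from [X] at no cost. *)
Fixpoint restrict_block (i : 'I_k) (X : cube index)
    (T : dtree index (cube 'I_k)) : dtree 'I_n pm1 :=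
  match T with
  | Leaf l => Leaf (l i)
  | Query p T0 T1 =>
      if p.1 == i then Query p.2 (restrict_block i X T0) (restrict_block i X T1)
      else restrict_block i X (if X p then T1 else T0)
  end.

Lemma restrict_block_eval i X T x :
  dtree_eval (restrict_block i X T) x = dtree_eval T (set_block X i x) i.
Proof.
elim: T => //= p T0 IH0 T1 IH1; rewrite ffunE.
by case: eqP => /= _; [case: (x p.2)|case: (X p)].
Qed.

Lemma restrict_block_queried i X T x :
  queried (restrict_block i X T) x =
  [set j | (i, j) \in queried T (set_block X i x)]%SET.
Proof.
elim: T => [l|[a j] T0 IH0 T1 IH1] /=.
  by apply/finset.setP => j; rewrite !inE.
rewrite ffunE /=; have [->|ai] := eqVneq a i => /=.
  by apply/finset.setP => j'; case: (x j); rewrite ?IH0 ?IH1 !inE xpair_eqE eqxx.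
apply/finset.setP => j'.
by case: (X _); rewrite ?IH0 ?IH1 !inE xpair_eqE eq_sym (negbTE ai).
Qed.

Lemma sum_card_block (Q : {set index}) :
  (\sum_(i < k) #|[set j | (i, j) \in Q]%SET| = #|Q|)%N.
Proof.
rewrite -[in RHS]sum1_card [in RHS]big_mkcond /=.
rewrite [RHS](eq_bigr (fun p : index => if (p.1, p.2) \in Q then 1%N else 0%N)); last by case.
rewrite -(pair_bigA _ (fun i j => if (i, j) \in Q then 1%N else 0%N)) /=.
apply: eq_bigr => i _; rewrite -sum1_card [RHS]big_mkcond /= big_mkcond.
by apply: eq_bigr => j _; rewrite inE.
Qed.

Variables (R : realType) (mu : fdist R (cube 'I_n)).

(* [(X, x) |-> (set_block X i x, block X i)] is a measure-preserving involution. *)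
Lemma fdist_pow_resample (F : cube index -> R) (i : 'I_k) :
  \sum_X fdist_pow mu k X * F X =
  \sum_X fdist_pow mu k X * \sum_x mu x * F (set_block X i x).
Proof.
pose g (u : cube index * cube 'I_n) := (set_block u.1 i u.2, block u.1 i).
have gK : involutive g.
  by case=> X x; rewrite /g /= set_blockK block_set_block eqxx.
transitivity (\sum_(u : cube index * cube 'I_n) fdist_pow mu k u.1 * mu u.2 * F u.1).
  rewrite -(pair_bigA _ (fun X x => fdist_pow mu k X * mu x * F X)) /=.
  apply: eq_bigr => X _; rewrite -mulr_suml -mulr_sumr pmf_sum1; ring.
rewrite (reindex g) /=; last by exists g => u _; exact: gK.
under [RHS]eq_bigr do rewrite mulr_sumr.
rewrite pair_bigA /=; apply: eq_bigr => -[X x] _ /=; rewrite mulrA; congr (_ * _).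
rewrite /fdist_pow_pmf (bigD1 i) //= [in RHS](bigD1 i) //= block_set_block eqxx.
rewrite (eq_bigr (fun j => mu (block X j))) => [|j /negbTE ji]; last first.
  by rewrite block_set_block ji.
ring.
Qed.

End Blocks.

(** * Success and correlation of trees for the direct product *)

Section DirectProduct.
Variables (R : realType) (n k : nat) (f : cube 'I_n -> pm1) (H : cube 'I_n -> R).
Hypothesis H01 : forall x, 0 <= H x <= 1.
Local Notation index := ('I_k * 'I_n)%type.

Definition sgn_eq (b c : bool) : R := if b == c then 1 else -1.

Definition hard_corr (T : dtree index (cube 'I_k)) (i : 'I_k) (X : cube index) : R :=
  H (block X i) * sgn_eq (dtree_eval T X i) (f (block X i)).

(* [T'] is [T] with each leaf relabelled, in every block, by the label that agrees
   best with [f] under the weights [w i * H] at that leaf. *)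
Lemma product_tree_bound (p : R) (T : dtree index (cube 'I_k))
    (w : 'I_k -> cube 'I_n -> R) : 0 < p -> (forall i x, 0 <= w i x) ->
  exists2 T' : dtree index (cube 'I_k), queried T' =1 queried T &
    \sum_X (\prod_i w i (block X i)) * (dtree_eval T X == direct_product f X)%:R <=
      expR (p / 2) * \sum_X (\prod_i w i (block X i)) * \prod_i (1 - H (block X i) / 4)
      + p^-1 * \sum_i \sum_X (\prod_i w i (block X i)) * hard_corr T' i X.
Proof.
move=> p0; elim: T w => [l|[i j] T0 IH0 T1 IH1] w w0 /=.
  pose corr i b := \sum_x w i x * (H x * sgn_eq b (f x)).
  (* Flipping a label negates its correlation, so the better label has a nonnegative one. *)
  have corrN i b : corr i (~~ b) = - corr i b.
    rewrite /corr -sumrN; apply: eq_bigr => x _; rewrite /sgn_eq.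
    by case: b; case: (f x) => /=; ring.
  pose c i := 0 <= corr i true; pose a i := corr i (c i).
  have a_ge i b : corr i b <= a i /\ 0 <= a i.
    rewrite /a /c; case: (leP 0 (corr i true)); have := corrN i true => /= E;
    by case: b; rewrite ?E; lra.
  exists (Leaf [ffun i => c i]) => //.
  pose m i := \sum_x w i x; pose h i := \sum_x w i x * H x.
  have hm i : h i <= m i.
    apply: ler_sum => x _; rewrite ler_piMr //; by case/andP: (H01 x).
  have ah i : 0 <= a i <= h i.
    rewrite (proj2 (a_ge i true)) /=; apply: ler_sum => x _; rewrite ler_wpM2l //.
    by case/andP: (H01 x); rewrite /sgn_eq; case: eqP => _ *; lra.
  have -> : \sum_X (\prod_i w i (block X i)) * (l == direct_product f X)%:R =
            \prod_i \sum_x w i x * (l i == f x)%:R.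
    rewrite -sum_prod_block; apply: eq_bigr => X _; rewrite big_split /=; congr (_ * _).
    have [->|lX] := eqVneq l (direct_product f X).
      by rewrite big1 // => i _; rewrite ffunE eqxx.
    have [i li] : exists i, l i != f (block X i).
      apply/existsP; rewrite -negb_forall; apply: contra lX => /forallP lX.
      by apply/eqP/ffunP => i; rewrite ffunE; apply/eqP.
    by rewrite (bigD1 i) //= (negbTE li) mul0r.
  (* Pointwise, success in block [i] is at most [1 - H x * (1 - sgn_eq (l i) (f x)) / 2]: an error
     is charged only with weight [H x]. *)
  apply: (@le_trans _ _ (\prod_i (m i - (h i - a i) / 2))).
    apply: ler_prod => i _; rewrite sumr_ge0 /= => [|x _]; last by rewrite mulr_ge0.
    apply: (@le_trans _ _ (m i - (h i - corr i (l i)) / 2)); last first.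
      by have := proj1 (a_ge i (l i)); lra.
    rewrite /m /h /corr -sumrB mulr_suml -sumrB; apply: ler_sum => x _.
    rewrite [leRHS](_ : _ = w i x * (1 - (H x - H x * sgn_eq (l i) (f x)) / 2)); last by ring.
    rewrite ler_wpM2l // /sgn_eq.
    by case/andP: (H01 x); case: eqP => _ /= *; lra.
  apply: (le_trans (leaf_bound p0 ah hm)).
  rewrite le_eqVlt; apply/orP; left; apply/eqP; congr (_ * _ + _ * _).
    under [RHS]eq_bigr do rewrite -big_split /=.
    rewrite (sum_prod_block (fun i x => w i x * (1 - H x / 4))).
    apply: eq_bigr => i _; rewrite /m /h mulr_suml -sumrB.
    by apply: eq_bigr => x _; ring.
  apply: eq_bigr => i _.
  pose F i' x := if i' == i then w i x * (H x * sgn_eq (c i) (f x)) else w i' x.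
  transitivity (\prod_i' \sum_x F i' x).
    rewrite [RHS](bigD1 i) //= /F /= eqxx; congr (_ * _).
    by apply: eq_bigr => i' /negbTE ->.
  rewrite -sum_prod_block; apply: eq_bigr => X _.
  rewrite /hard_corr /= ffunE (bigD1 i) //= [in RHS](bigD1 i) //= /F /= eqxx.
  rewrite (eq_bigr (fun i' => w i' (block X i'))) => [|i' /negbTE -> //]; ring.
(* A query splits the weight of its own block only, so the weights keep their product form down to
   the leaves; hence the induction over arbitrary [w]. *)
pose wr b i' x := if i' == i then w i' x * (x j == b)%:R else w i' x.
have wr0 b i' x : 0 <= wr b i' x by rewrite /wr; case: ifP; rewrite ?mulr_ge0.
have wrE b X : \prod_i' wr b i' (block X i') =
               (\prod_i' w i' (block X i')) * (X (i, j) == b)%:R.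
  rewrite (bigD1 i) //= [in RHS](bigD1 i) //= /wr eqxx ffunE.
  rewrite (eq_bigr (fun i' => w i' (block X i'))) => [|i' /negbTE -> //]; ring.
have split (F F0 F1 : cube index -> R) : (forall X, F X = if X (i, j) then F1 X else F0 X) ->
    \sum_X (\prod_i w i (block X i)) * F X =
    \sum_X (\prod_i wr false i (block X i)) * F0 X +
    \sum_X (\prod_i wr true i (block X i)) * F1 X.
  move=> FE; rewrite -big_split; apply: eq_bigr => X _ /=.
  by rewrite !wrE FE; case: (X _) => /=; ring.
have [T0' Q0 le0] := IH0 (wr false) (wr0 false).
have [T1' Q1 le1] := IH1 (wr true) (wr0 true).
exists (Query (i, j) T0' T1').
  by move=> X /=; case: ifP; rewrite ?Q0 ?Q1.
rewrite (split _ (fun X => (dtree_eval T0 X == direct_product f X)%:R)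
                 (fun X => (dtree_eval T1 X == direct_product f X)%:R)); last first.
  by move=> X; case: ifP.
rewrite (split _ (fun X => \prod_i (1 - H (block X i) / 4))
                 (fun X => \prod_i (1 - H (block X i) / 4))); last first.
  by move=> X; case: ifP.
rewrite [X in _ + _ * X](eq_bigr (fun i' =>
    \sum_X (\prod_i wr false i (block X i)) * hard_corr T0' i' X +
    \sum_X (\prod_i wr true i (block X i)) * hard_corr T1' i' X)); last first.
  by move=> i' _; apply: split => X; rewrite /hard_corr /=; case: ifP.
by rewrite big_split /= !mulrDr addrACA; apply: lerD.
Qed.

Variable mu : fdist R (cube 'I_n).

(** Resampling block [i] with the others fixed turns [T] into a tree for [f], to which the
    hypothesis applies. The expected numbers of queries in the blocks add up to the depth of [T]. *)
Lemma hard_corr_bound (a b : R) (T : dtree index (cube 'I_k)) :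
    (forall S : dtree 'I_n pm1,
       \sum_x mu x * (H x * agree R f S x) <= a * dtree_depth mu S + b) ->
  \sum_i \sum_X fdist_pow mu k X * hard_corr T i X <=
    a * dtree_depth (fdist_pow mu k) T + b * k%:R.
Proof.
move=> hard.
have -> : a * dtree_depth (fdist_pow mu k) T + b * k%:R = \sum_(i < k)
   (a * (\sum_X fdist_pow mu k X * #|[set j | (i, j) \in queried T X]%SET|%:R) + b).
  rewrite big_split /= sumr_const card_ord mulr_natr; congr (_ + _).
  rewrite -mulr_sumr exchange_big /=; congr (_ * _); apply: eq_bigr => X _.
  by rewrite -mulr_sumr -natr_sum sum_card_block.
apply: ler_sum => i _; rewrite (fdist_pow_resample mu (hard_corr T i) i).
rewrite (fdist_pow_resample mu (fun X => #|[set j | (i, j) \in queried T X]%SET|%:R) i).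
rewrite -[b](sum_fdist_const (fdist_pow mu k)) mulr_sumr -big_split /=.
apply: ler_sum => X _.
rewrite mulrCA -mulrDr ler_wpM2l ?(Defs.pmf_ge0 (fdist_pow mu k)) //.
have := hard (restrict_block i X T).
congr (_ <= _).
  apply: eq_bigr => x _; congr (_ * _).
  by rewrite /hard_corr /agree /sgn_eq restrict_block_eval block_set_block eqxx.
congr (_ * _ + _); apply: eq_bigr => x _.
by rewrite restrict_block_queried.
Qed.

End DirectProduct.

(** * Tradeoff between error and depth for a deterministic tree *)

Section DeterministicBound.
Variables (R : realType) (n k : nat) (f : cube 'I_n -> pm1) (mu : fdist R (cube 'I_n)).

(** Being linear in error and depth, the bound survives averaging over a random tree. *)
Lemma product_dtree_error (gamma delta D : R) (T : dtree ('I_k * 'I_n)%type (cube 'I_k)) :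
    0 < gamma < 1 -> 0 < delta <= 1 / 2 -> 0 < D -> (0 < k)%N ->
    (forall T : dtree 'I_n pm1, dtree_error mu f T <= delta -> D <= dtree_depth mu T) ->
  1 - expR (- (1 / 32 * delta * k%:R)) - gamma / 2 <=
    dtree_error (fdist_pow mu k) (direct_product f) T +
    16 * 224 * 80 * ln (1 / delta) / (gamma * D * k%:R)
      * dtree_depth (fdist_pow mu k) T.
Proof.
move=> /andP[g0 g1] d01 D0 kpos hard; have /andP[d0 d1] := d01.
have k0 : 0 < k%:R :> R by rewrite ltr0n.
(* The additive term [5 / 2 * (gamma / 80 * delta) * k%:R] of the correlation bound, divided by [p],
   is then [gamma / 2]. *)
have g80 : 0 < gamma / 80 < 1 by apply/andP; split; lra.
have [H [H01 dens corr]] := hardcore g80 d01 D0 hard.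
(* The product of the [1 - H / 4] averages to at most [expR (- (delta * k%:R / 16))]; the factor
   [expR (p / 2)] gives up half of that exponent. *)
pose p := delta * k%:R / 16.
have p0 : 0 < p by rewrite /p divr_gt0 ?mulr_gt0.
have [T' QT le_succ] := @product_tree_bound R n k f H H01 p T (fun=> mu) p0
  (fun=> Defs.pmf_ge0 mu).
have errE : \sum_X (\prod_(i < k) mu (block X i)) * (dtree_eval T X == direct_product f X)%:R
    = 1 - dtree_error (fdist_pow mu k) (direct_product f) T.
  rewrite -[X in _ = X - _](pmf_sum1 (fdist_pow mu k)) -sumrB; apply: eq_bigr => X _.
  by rewrite /= /fdist_pow_pmf; case: (_ == _) => /=; ring.
have := hard_corr_bound T' corr; set S := \sum_(i < k) _ => le_S.
have depthE : dtree_depth (fdist_pow mu k) T' = dtree_depth (fdist_pow mu k) T.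
  by apply: eq_bigr => X _; rewrite QT.
have resil : expR (p / 2) * (\sum_X (\prod_i mu (block X i)) *
      \prod_(i < k) (1 - H (block X i) / 4)) <= expR (- (1 / 32 * delta * k%:R)).
  under eq_bigr do rewrite -big_split /=.
  rewrite (sum_prod_block (fun i x => mu x * (1 - H x / 4))) prodr_const card_ord.
  have -> : expR (- (1 / 32 * delta * k%:R)) = expR (p / 2) * expR (- (delta / 16)) ^+ k.
    by rewrite -expRM_natl -expRD /p; congr expR; field.
  rewrite ler_wpM2l ?expR_ge0 // lerXn2r ?nnegrE ?expR_ge0 //.
    apply: sumr_ge0 => x _; rewrite mulr_ge0 ?Defs.pmf_ge0 //.
    by case/andP: (H01 x) => *; lra.
  apply: le_trans (expR_ge1Dx _).
  have -> : \sum_x mu x * (1 - H x / 4) = 1 - (\sum_x mu x * H x) / 4.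
    rewrite mulr_suml -[X in _ = X - _](pmf_sum1 mu) -sumrB.
    by apply: eq_bigr => x _; ring.
  by lra.
move: le_succ; rewrite errE => le_succ.
have : p^-1 * S <= gamma / 2 + 16 * 224 * 80 * ln (1 / delta) / (gamma * D * k%:R)
      * dtree_depth (fdist_pow mu k) T.
  rewrite ler_pdivrMl //; apply: (le_trans le_S); rewrite depthE.
  rewrite le_eqVlt; apply/orP; left; apply/eqP; rewrite /p; field.
  by rewrite !gt_eqF.
move: le_succ resil; rewrite -/S; lra.
Qed.

End DeterministicBound.

(** * Averaging over random trees *)

Section Randomized.
Variables (R : realType) (I : finType) (L : pointedType).
Variables (mu : fdist R (cube I)) (g : cube I -> L).
Local Open Scope ereal_scope.

Lemma rtree_errorE (P : rtree R I L) :
  rtree_error mu g P = \int[P]_T (dtree_error mu g T)%:E.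
Proof.
rewrite /rtree_error /dtree_error.
under [RHS]eq_integral do rewrite -sumEFin.
rewrite ge0_integral_sum //=; last first.
  by move=> x T _; rewrite lee_fin mulr_ge0 ?Defs.pmf_ge0.
apply: eq_bigr => x _.
under [RHS]eq_integral do rewrite EFinM.
rewrite ge0_integralZl_EFin ?Defs.pmf_ge0 //=.
congr (_ * _); rewrite -[in LHS](setIT [set T | dtree_eval T x <> g x]%classic) -integral_indic //.
apply: eq_integral => T _; rewrite indicE; congr ((nat_of_bool _)%:R%:E).
by apply/idP/idP; rewrite inE => /eqP.
Qed.

Lemma rtree_tradeoff (a b : R) (P : rtree R I L) : (0 <= a)%R ->
    (forall T, (b <= dtree_error mu g T + a * dtree_depth mu T)%R) ->
  b%:E <= rtree_error mu g P + a%:E * rtree_depth mu P.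
Proof.
move=> a0 bT.
have e0 T : (0 <= dtree_error mu g T)%R.
  by apply: sumr_ge0 => x _; rewrite mulr_ge0 ?Defs.pmf_ge0.
have d0 := @dtree_depth_ge0 _ _ mu L.
rewrite rtree_errorE /rtree_depth -ge0_integralZl_EFin //; last first.
  by move=> T _; rewrite lee_fin.
rewrite -ge0_integralD //; last 2 first.
- by move=> T _; rewrite lee_fin.
- by move=> T _; rewrite mule_ge0 ?lee_fin.
(* The comparison of integrals below is for nonnegative integrands; a negative [b] is trivial. *)
have [b0|b0] := leP 0%R b; last first.
  apply: (@le_trans _ _ 0); first by rewrite lee_fin ltW.
  by apply: integral_ge0 => T _ /=; rewrite adde_ge0 ?mule_ge0 ?lee_fin.
have -> : b%:E = \int[P]_T b%:E.
  by rewrite integral_cst //= probability_setT mule1.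
apply: ge0_le_integral => //=.
by move=> T _; rewrite -EFinM -EFinD lee_fin.
Qed.

Lemma Depth_le_dtree (eps : R) (T : dtree I L) :
  (dtree_error mu g T <= eps)%R -> Depth mu g eps <= (dtree_depth mu T)%:E.
Proof.
move=> errT; apply: ereal_inf_lbound.
exists (\d_T : probability _ _).
  rewrite /= rtree_errorE integral_dirac //= diracT mul1e lee_fin //.
by rewrite /rtree_depth integral_dirac //= diracT mul1e.
Qed.

Lemma Depth_ge0 (eps : R) : 0 <= Depth mu g eps.
Proof.
apply: le_ereal_inf_tmp => _ [P _ <-]; apply: integral_ge0 => T _.
by rewrite lee_fin dtree_depth_ge0.
Qed.

End Randomized.

(** * Infinite depth, large [delta], and the final constants *)

(** Allows work with real lower bounds [D] on a depth that is an infimum and a priori may be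
    infinite. *)
Lemma lee_mul_real_approx (R : realType) (c : R) (x y : \bar R) :
    0 < c -> (0 <= x)%E -> (0 <= y)%E ->
    (forall D : R, 0 < D -> (D%:E <= x)%E -> ((c * D)%:E <= y)%E) ->
  (c%:E * x <= y)%E.
Proof.
move=> c0; case: x => [r|_|//].
  rewrite lee_fin le_eqVlt => /predU1P[<-|r0] y0 cD; first by rewrite mule0.
  by rewrite -EFinM cD.
move=> y0 cD; rewrite gt0_muley ?lte_fin //.
suff -> : y = +oo%E by [].
apply/eqyP => A A0; have := cD (A / c).
by rewrite (mulrC c) divfK ?gt_eqF //; apply; rewrite ?leey ?divr_gt0.
Qed.

(** The errors of the two constant trees sum to 1, so one of them is at most 1/2. *)
Lemma Depth_half (R : realType) (I : finType) (f : cube I -> pm1)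
    (mu : fdist R (cube I)) (delta : R) :
  1 / 2 <= delta -> Depth mu f delta = 0%E.
Proof.
move=> d1; apply/eqP; rewrite eq_le Depth_ge0 andbT.
have leaf0 b : dtree_depth mu (Leaf b : dtree I pm1) = 0.
  by apply: big1 => x _; rewrite /= finset.cards0 mulr0.
have sum1 : dtree_error mu f (Leaf true) + dtree_error mu f (Leaf false) = 1.
  rewrite -(pmf_sum1 mu) -big_split; apply: eq_bigr => x _ /=.
  by case: (f x) => /=; ring.
have [b eb] : exists b, dtree_error mu f (Leaf b) <= delta.
  have [le|gt] := leP (dtree_error mu f (Leaf true)) delta; first by exists true.
  by exists false; lra.
by have := Depth_le_dtree eb; rewrite leaf0.
Qed.

Theorem theorem4p1 (R : realType) :
  exists c1 c2 : R, 0 < c1 /\ 0 < c2 /\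
    forall (n : nat) (f : cube 'I_n -> pm1) (mu : fdist R (cube 'I_n))
           (k : nat) (gamma delta : R),
      0 < gamma < 1 -> 0 < delta < 1 ->
      ((c2 * (gamma ^+ 2 * k%:R / ln (1 / delta)))%:E * Depth mu f delta
         <= Depth (fdist_pow mu k) (direct_product (k := k) f)
              (1 - expR (- (c1 * delta * k%:R)) - gamma))%E.
Proof.
(* The factors come from [1 / p], from [hardcore] and from rescaling [gamma]. The extra 2 in [c2]
   reflects the [gamma / 2] left by [product_dtree_error]. *)
pose K : R := 16 * 224 * 80.
have K0 : 0 < K by rewrite /K !mulr_gt0.
exists (1 / 32), (1 / (2 * K)); do 2![split; first by rewrite divr_gt0 ?mulr_gt0].
move=> n f mu k gamma delta g01 /andP[d0 d1]; have /andP[g0 g1] := g01.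
have [half|d_half] := ltP (1 / 2) delta.
  by rewrite (Depth_half _ _ (ltW half)) mule0 Depth_ge0.
case: (posnP k) => [->|kpos]; first by rewrite mulr0 mul0r mulr0 mul0e Depth_ge0.
have k0 : 0 < k%:R :> R by rewrite ltr0n.
have L0 : 0 < ln (1 / delta) by apply: lt_le_trans (ln_inv_ge d0); lra.
set L := ln _ in L0 *.
apply: le_ereal_inf_tmp => _ [P /= errP <-].
have Q0 : (0 <= rtree_depth (fdist_pow mu k) P)%E.
  by apply: integral_ge0 => T _; rewrite lee_fin dtree_depth_ge0.
apply: lee_mul_real_approx => //.
- by rewrite !mulr_gt0 ?invr_gt0 ?exprn_gt0 // mulr_gt0.
- exact: Depth_ge0.
move=> D D0 DD.
have hard T : dtree_error mu f T <= delta -> D <= dtree_depth mu T.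
  by move=> /Depth_le_dtree; rewrite -lee_fin; exact: le_trans.
pose a := K * L / (gamma * D * k%:R).
have a0 : 0 < a by rewrite /a divr_gt0 ?mulr_gt0.
have d01 : 0 < delta <= 1 / 2 by rewrite d0.
have := rtree_tradeoff P (ltW a0) (fun T => product_dtree_error T g01 d01 D0 kpos hard).
move: Q0; case: (rtree_depth _ P) => [q|_ _|//]; last by rewrite leey.
move=> _ /le_trans /(_ (leeD2r _ errP)).
rewrite -EFinM -EFinD !lee_fin => le_q.
have {}le_q : gamma / 2 <= a * q by lra.
have -> : 1 / (2 * K) * (gamma ^+ 2 * k%:R / L) * D = gamma / 2 / a.
  by rewrite /a; field; rewrite !gt_eqF.
by rewrite ler_pdivrMr // [leRHS]mulrC.
Qed.
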